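(* Let $p,q,r$ be integers with $p\ge r>0$, $q>0$ and $p\not\equiv 0\pmod q$. Then: (1) if $r\equiv 1$, $q$, or $2q-1\pmod{2q}$, then $NC(p,q;r,q)=\gcd(p,q)$; (2) if $r>q$, then $NC(p,q;r,-q)=r-q+\gcd(q,r-p)$.
   Context: For positive integers $p\ge r>0$ and integers $q,s$, the twisted torus link $T(p,q;r,s)$ is the closure of the braid on $p$ strands $(\sigma_1\sigma_2\cdots\sigma_{p-1})^q(\sigma_1\cdots\sigma_{r-1})^s$, where $\sigma_1,\dots,\sigma_{p-1}$ are the standard generators of the braid group on $p$ strands (an empty product is the trivial braid). $NC(p,q;r,s)$ denotes the number of components of the link $T(p,q;r,s)$. By convention $\gcd(a,0)=|a|$. *)

(* Defs.v *)
From mathcomp Require Import all_boot all_order all_algebra finmap.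
From mathcomp Require Import all_classical all_reals all_analysis.
Set Implicit Arguments.
Unset Strict Implicit.
Unset Printing Implicit Defensive.
Import Order.TTheory GRing.Theory Num.Theory.
Import numFieldNormedType.Exports.
Local Open Scope classical_set_scope.
Local Open Scope ring_scope.

(* Words in the standard generators of the braid group on p strands: with
   k : 'I_p.-1 (numbered from 0), (k, true) is sigma_(k+1) and (k, false) is
   its inverse. *)
Definition braid_word (p : nat) := seq ('I_p.-1 * bool).

Definition braid_inv (p : nat) (w : braid_word p) : braid_word p :=
  rev [seq (e.1, ~~ e.2) | e <- w].

Definition braid_exp (p : nat) (w : braid_word p) (n : int) : braid_word p :=
  match n with
  | Posz m => flatten (nseq m w)
  | Negz m => flatten (nseq m.+1 (braid_inv w))
  end.

(* sigma_1 sigma_2 ... sigma_(m-1), for m <= p; [enum] lists ordinals in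
   increasing order. *)
Definition sigma_prod (p m : nat) : braid_word p :=
  [seq (k, true) | k : 'I_p.-1 <- enum 'I_p.-1 & (k < m.-1)%N].

Definition twisted_torus_braid (p : nat) (q : int) (r : nat) (s : int) :
    braid_word p :=
  braid_exp (sigma_prod p p) q ++ braid_exp (sigma_prod p r) s.

Definition swap_next (k i : nat) : nat :=
  if i == k then k.+1 else if i == k.+1 then k else i.

(* Geometric braids live in R^3 with coordinates (x, y, t), the strands being
   monotone in t; position i (numbered from 0) is the point x = i + 1, y = 0.
   [crossing_strand e i u] is the pair (x, y) at time u in [0, 1] of the strand
   that enters the crossing e in position i.  The two strands that cross are
   kept apart by the sign of y; all other strands are straight. *)
Definition crossing_strand (R : realType) (p : nat) (e : 'I_p.-1 * bool)
    (i : nat) (u : R) : R * R :=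
  ((1 - u) * i.+1%:R + u * (swap_next e.1 i).+1%:R,
   (if e.2 then 1 else -1) * ((i == e.1 :> nat)%:R - (i == e.1.+1 :> nat)%:R)
     * (u * (1 - u))).

(* The t-th letter of w occupies the slab [t, t + 1]. *)
Definition geometric_braid (R : realType) (p : nat) (w : braid_word p) :
    set (R * R * R) :=
  [set z | exists (t : 'I_(size w)) (i : 'I_p) (u : R),
     [/\ 0 <= u, u <= 1
       & z = (crossing_strand (tnth (in_tuple w) t) i u, t%:R + u)]].
Arguments geometric_braid R {p} w.

(* Straight strands in the slab [size w, size w + 1], which become the arcs
   joining the end points of the braid to its starting points. *)
Definition closing_strands (R : realType) (p : nat) (w : braid_word p) :
    set (R * R * R) :=
  [set z | exists (i : 'I_p) (u : R),
     [/\ 0 <= u, u <= 1 & z = (i.+1%:R, 0, (size w)%:R + u)]].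
Arguments closing_strands R {p} w.

(* Bends the slab 0 <= t <= h, x > 0 once around an axis of R^3, so that the
   planes t = 0 and t = h are glued. *)
Definition around_axis (R : realType) (h : R) (z : R * R * R) : R * R * R :=
  let: (x, y, t) := z in
  let theta := 2 * pi * t / h in
  (x * cos theta, x * sin theta, y).

Definition braid_closure (R : realType) (p : nat) (w : braid_word p) :
    set (R * R * R) :=
  around_axis (size w).+1%:R @` (geometric_braid R w `|` closing_strands R w).
Arguments braid_closure R {p} w.

Definition twisted_torus_link (R : realType) (p : nat) (q : int) (r : nat)
    (s : int) : set (R * R * R) :=
  braid_closure R (twisted_torus_braid p q r s).
Arguments twisted_torus_link : clear implicits.

(* [fset_set] of an infinite set is empty, so a positive value of
   [num_components A] means that A has exactly that many components. *)
Definition num_components (T : topologicalType) (A : set T) : nat :=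
  #|` fset_set [set connected_component A x | x in A] |.

Definition NC (R : realType) (p : nat) (q : int) (r : nat) (s : int) : nat :=
  num_components (twisted_torus_link R p q r s).
Arguments NC : clear implicits.

(* Main.v *)
(* The closure of a braid is a finite union of compact arcs, one for each slab and
   each strand.  Two arcs can only meet if their strands lie in the same orbit of
   the permutation of the braid, and the arcs of an orbit form a connected set, so
   the components correspond to the orbits of the permutation.  For T(p,q;r,s) this
   permutation subtracts q modulo p, and then s modulo r on [0, r).  Following the
   orbits down by steps of q and 2q, one finds those of the rotation by p on Z/q
   when s = q, and, when s = -q, the r - q fixed points in [q, r) together with the
   rotation by p - r on p - r + q points. *)
Require Import Defs.
From mathcomp Require Import all_boot all_order all_algebra finmap.
From mathcomp Require Import all_classical all_reals all_analysis.
From mathcomp Require Import zify ring lra.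
Import Order.TTheory GRing.Theory Num.Theory.
Import numFieldNormedType.Exports.
Local Open Scope classical_set_scope.
Local Open Scope ring_scope.

Set Implicit Arguments.
Unset Strict Implicit.
Unset Printing Implicit Defensive.

(** * Components of the closure of a braid *)

(** The pieces being finitely many and closed, the union of one class and the union of the others
    are closed and disjoint, hence separated, so a component meeting a class stays inside it. The
    linking hypothesis gives the reverse inclusion. *)
Lemma num_components_classifier (T : topologicalType) (A : set T) (F : finType)
    (K : F -> set T) (N : nat) (c : F -> 'I_N) :
  A = \bigcup_(a in setT) K a ->
  (forall a, closed (K a)) -> (forall a, K a !=set0) ->
  (forall a b, K a `&` K b !=set0 -> c a = c b) ->
  (forall k, exists a, c a = k) ->
  (forall a b x y, c a = c b -> K a x -> K b y -> connected_component A x y) ->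
  num_components A = N.
Proof.
move=> defA clK neK dK surj_c linkK.
pose E k := \bigcup_(a in [set a | c a = k]) K a.
have clE (P : 'I_N -> Prop) : closed (\bigcup_(a in [set a | P (c a)]) K a).
  by apply: closed_bigcup => [|a _]; [exact: finite_finset | exact: clK].
have compE a x : K a x -> connected_component A x = E (c a).
  move=> Kax; apply/seteqP; split=> [y|y [b cb Kby]]; last exact: (linkK a b _ _ (esym cb)).
  have Ax : A x by rewrite defA; exists a.
  pose E' := \bigcup_(b in [set b | c b <> c a]) K b.
  have sepE : separated (E (c a)) E'.
    have EE' : E (c a) `&` E' = set0.
      rewrite -subset0 => z [[b cb Kbz] [b' cb' Kbz']]; apply: cb'.
      by rewrite -cb; apply: dK; exists z.
    by split; rewrite -?(closure_id _).1 // /E /E';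
      [exact: (clE (fun k => k = c a)) | exact: (clE (fun k => k <> c a))].
  have sub : connected_component A x `<=` E (c a) `|` E'.
    move=> z /connected_component_sub; rewrite defA => -[b _ Kbz].
    by have [cb|cb] := pselect (c b = c a); [left|right]; exists b.
  have [/(_ y)//|/(_ x)] := connected_subset sepE sub (@component_connected _ A x).
  move=> /(_ (connected_component_refl Ax)) [b cb Kbx] _.
  by case: cb; apply: dK; exists x.
have -> : num_components A = #|` fset_set (E @` setT)|.
  rewrite /num_components; congr (#|` fset_set _|); apply/seteqP; split=> [_ [x + <-]|_ [k _ <-]].
    by rewrite {1}defA => -[a _ Kax]; exists (c a) => //; rewrite (compE a).
  have [a <-] := surj_c k; have [x Kax] := neK a.
  by exists x; [rewrite defA; exists a | exact: compE].
apply: card_fset_set.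
apply: (card_eq_trans (inj_card_eq _)); last by rewrite card_eq_sym card_II.
move=> k k' _ _ Ekk'; have [a ca] := surj_c k; have [x Kax] := neK a.
have : E k' x by rewrite -Ekk'; exists a.
by case=> b <- Kbx; rewrite -ca; apply: dK; exists x.
Qed.

(** * Wrapping a slab around the axis *)

Lemma cos_eq1 (R : realType) (z : R) :
  0 <= z -> z <= 2 * pi -> cos z = 1 -> z = 0 \/ z = 2 * pi.
Proof.
(* The half-angle formula gives [sin (z / 2) = 0], whereas the sine is positive strictly between 0
   and [pi]. *)
move=> z0 z2 cz; have := cos2Dsin2 (z / 2).
have : cos z = cos (z / 2) ^+ 2 *+ 2 - 1 by rewrite -cos_mulr2n; congr cos; lra.
rewrite cz => cz2 cs; have sz0 : sin (z / 2) = 0.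
  by apply/eqP; rewrite -sqrf_eq0; apply/eqP; lra.
have [->|zn0] := eqVneq z 0; [by left|right].
apply/eqP; rewrite eq_le z2 /= leNgt; apply/negP => zlt.
have z0' : 0 < z by rewrite lt_neqAle eq_sym zn0.
suff : 0 < sin (z / 2) by rewrite sz0 ltxx.
by apply: sin_gt0_pi; apply/andP; split; lra.
Qed.

Lemma cos_sin_inj (R : realType) (a b : R) :
  0 <= a -> a <= b -> b <= 2 * pi -> cos a = cos b -> sin a = sin b ->
  a = b \/ a = 0 /\ b = 2 * pi.
Proof.
move=> a0 ab b2 cab sab.
have : cos (b - a) = 1 by rewrite cosB cab sab -!expr2 cos2Dsin2.
by move=> /cos_eq1 [] *; [lra|lra|left; lra|right; split; lra].
Qed.

(** Squaring the first two coordinates recovers the radius [x]; cosine and sine then recover the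
    angle, except that both ends of a full turn agree. *)
Lemma around_axis_inj (R : realType) (h x y s x' y' s' : R) :
  0 < x -> 0 < x' -> 0 <= s <= h -> 0 <= s' <= h ->
  around_axis h (x, y, s) = around_axis h (x', y', s') ->
  [/\ x = x', y = y' & [\/ s = s', s = 0 /\ s' = h | s = h /\ s' = 0]].
Proof.
wlog ss' : x y s x' y' s' / s <= s'.
  move=> H x0 x'0 sh s'h E; case/orP: (le_total s s') => [ss'|s's]; first exact: H.
  by have [-> -> [->|[-> ->]|[-> ->]]] := H _ _ _ _ _ _ s's x'0 x0 s'h sh (esym E);
    split=> //; [constructor 1|constructor 3|constructor 2].
move=> x0 x'0 /andP[s0 _] /andP[_ s'h].
case; set a := 2 * pi * s / h; set b := 2 * pi * s' / h => xc xs ->.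
have xx' : x = x'.
  have sq (r z : R) : r ^+ 2 = (r * cos z) ^+ 2 + (r * sin z) ^+ 2.
    by rewrite !exprMn -mulrDr cos2Dsin2 mulr1.
  by apply/eqP; rewrite -(eqrXn2 (n := 2)) ?ltW // (sq x a) (sq x' b) xc xs.
split=> //; rewrite -{}xx' in xc xs.
have [h0|hn0] := eqVneq h 0; first by constructor 1; lra.
have hp : 0 < h by rewrite lt_neqAle eq_sym hn0 /=; lra.
have pi0 := pi_gt0 R.
have cst : 0 < 2 * pi / h by rewrite divr_gt0 // mulr_gt0.
have tE r : 2 * pi * r / h = 2 * pi / h * r by ring.
have xn0 : x != 0 by rewrite gt_eqF.
have full : 2 * pi / h * h = 2 * pi :> R by rewrite divfK.
have [a0 ab b2] : [/\ 0 <= a, a <= b & b <= 2 * pi].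
  by rewrite -full /a /b !tE !ler_pM2l // mulr_ge0 // ltW.
have [|[]] := cos_sin_inj a0 ab b2 (mulfI xn0 xc) (mulfI xn0 xs).
  by rewrite /a /b !tE => /(mulfI (lt0r_neq0 cst)); constructor 1.
rewrite /a tE => /eqP; rewrite mulf_eq0 gt_eqF //= => /eqP ->.
by rewrite -full /b tE => /(mulfI (lt0r_neq0 cst)); constructor 2.
Qed.

Lemma around_axis_period (R : realType) (h x y : R) :
  h != 0 -> around_axis h (x, y, h) = around_axis h (x, y, 0).
Proof.
move=> hn0; rewrite /around_axis mulfK // mulr0 mul0r.
by rewrite mulr_natl cos2pi sin2pi cos0 sin0.
Qed.

Lemma around_axis_continuous (R : realType) (h t : R) (f g : R -> R) :
  continuous f -> continuous g ->
  continuous (fun u => around_axis h (f u, g u, t + u)).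
Proof.
move=> cf cg u.
have ca : (fun u : R => 2 * pi * (t + u) / h) @ u --> 2 * pi * (t + u) / h.
  apply: cvgMl; apply: cvgMr; apply: cvgD; [exact: cvg_cst|exact: cvg_id].
have cX : (fun u => f u * cos (2 * pi * (t + u) / h)) @ u -->
    f u * cos (2 * pi * (t + u) / h).
  by apply: cvgM; [exact: cf | apply: continuous_cvg ca; exact: continuous_cos].
have cY : (fun u => f u * sin (2 * pi * (t + u) / h)) @ u -->
    f u * sin (2 * pi * (t + u) / h).
  by apply: cvgM; [exact: cf | apply: continuous_cvg ca; exact: continuous_sin].
exact: cvg_pair (cvg_pair cX cY) (cg u).
Qed.

(** * Permutation and arcs of a braid word *)

Definition braid_perm (p : nat) (w : braid_word p) (i : nat) : nat :=
  foldl (fun j (e : 'I_p.-1 * bool) => swap_next e.1 j) i w.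

Lemma swap_nextK (k : nat) : involutive (swap_next k).
Proof. by move=> i; rewrite /swap_next; do !case: eqP => //=; lia. Qed.

Lemma swap_next_lt (p : nat) (k : 'I_p.-1) (i : nat) :
  (i < p)%N -> (swap_next k i < p)%N.
Proof. by have := ltn_ord k; rewrite /swap_next; do !case: eqP => //=; lia. Qed.

Lemma braid_perm_cat (p : nat) (w w' : braid_word p) (i : nat) :
  braid_perm (w ++ w') i = braid_perm w' (braid_perm w i).
Proof. exact: foldl_cat. Qed.

Lemma braid_perm_inv (p : nat) (w : braid_word p) :
  cancel (braid_perm w) (braid_perm (braid_inv w)).
Proof.
rewrite /braid_inv; elim: w => [|e w IH] i //=.
by rewrite rev_cons -cats1 braid_perm_cat IH /= swap_nextK.
Qed.

Lemma braid_invK (p : nat) : involutive (@braid_inv p).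
Proof.
move=> w; rewrite /braid_inv map_rev revK -map_comp map_id_in // => -[k b] _ /=.
by rewrite negbK.
Qed.

Lemma braid_perm_lt (p : nat) (w : braid_word p) (i : nat) :
  (i < p)%N -> (braid_perm w i < p)%N.
Proof. by elim: w i => //= e w IH i ip; apply: IH; exact: swap_next_lt. Qed.

(** [None] stands for the closing slab, whose strands are straight. *)
Definition crossing_perm (p : nat) (oe : option ('I_p.-1 * bool)) (i : nat) :=
  if oe is Some e then swap_next e.1 i else i.

Lemma braid_perm_takeS (p : nat) (w : braid_word p) (t i : nat) :
  braid_perm (take t.+1 w) i = crossing_perm (onth w t) (braid_perm (take t w) i).
Proof. by elim: w t i => [|e w IH] [|t] i //=; rewrite ?take0 // -IH. Qed.

(* The arc entering slab t in position i; slab [size w] is the one of the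
   closing strands. *)
Definition arc (R : realType) (p : nat) (w : braid_word p) (t i : nat) (u : R) :
    R * R * R :=
  (if onth w t is Some e then crossing_strand e i u else (i.+1%:R, 0), t%:R + u).
Arguments arc R {p} w t i u.

Lemma arc0 (R : realType) (p : nat) (w : braid_word p) (t i : nat) :
  arc R w t i 0 = (i.+1%:R, 0, t%:R).
Proof.
by rewrite /arc /crossing_strand; case: onth => *; congr (_, _, _); ring.
Qed.

Lemma arc1 (R : realType) (p : nat) (w : braid_word p) (t i : nat) :
  arc R w t i 1 = ((crossing_perm (onth w t) i).+1%:R, 0, t.+1%:R).
Proof.
rewrite /arc /crossing_strand; case: onth => [e|] /=; congr (_, _, _); ring.
Qed.

(** Two crossing strands share their abscissa only at [u = 1/2], where their [y] have opposite
    signs; the other strands are straight and stay away from the crossing pair. *)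
Lemma arc_inj (R : realType) (p : nat) (w : braid_word p) (t i j : nat) (u : R) :
  0 <= u <= 1 -> arc R w t i u = arc R w t j u -> i = j.
Proof.
move=> /andP[u0 u1]; rewrite /arc; case: onth => [[k b]|]; last first.
  by move=> [/eqP]; rewrite -!natr1 (inj_eq (addIr _)) eqr_nat => /eqP.
have far (l : nat) : l != k -> l != k.+1 ->
    l%:R + 1 <= k%:R :> R \/ k%:R + 2 <= l%:R :> R.
  by move=> lk lk1; rewrite natr1 -natrD !ler_nat; lia.
rewrite /crossing_strand /swap_next /= => -[].
have [->|ik] := eqVneq i k; last (have [->|ik1] := eqVneq i k.+1);
  (have [->|jk] := eqVneq j k; last (have [->|jk1] := eqVneq j k.+1)) => //=.
all: rewrite ?eqxx ?(gtn_eqF (leqnn _)) ?(ltn_eqF (leqnn _)).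
all: rewrite -?natr1 ?mulr0n => xE yE.
- have uE : u = 2^-1 by lra.
  by exfalso; move: yE; rewrite uE; case: (b); lra.
- by exfalso; case: (far j) => // ?; lra.
- have uE : u = 2^-1 by lra.
  by exfalso; move: yE; rewrite uE; case: (b); lra.
- by exfalso; case: (far j) => // ?; lra.
- by exfalso; case: (far i) => // ?; lra.
- by exfalso; case: (far i) => // ?; lra.
- have/eqP : i%:R = j%:R :> R by lra.
  by rewrite eqr_nat => /eqP.
Qed.

Lemma arc_gt0 (R : realType) (p : nat) (w : braid_word p) (t i : nat) (u : R) :
  0 <= u <= 1 -> 0 < (arc R w t i u).1.1.
Proof.
move=> /andP[u0 u1]; rewrite /arc; case: onth => [e|] /=; last by rewrite ltr0n.
have a0 : 0 <= i%:R :> R by [].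
have b0 : 0 <= (swap_next e.1 i)%:R :> R by [].
rewrite -!natr1; nra.
Qed.

Lemma around_axis_arc_continuous (R : realType) (p : nat) (w : braid_word p)
    (h : R) (t i : nat) : continuous (fun u => around_axis h (arc R w t i u)).
Proof.
rewrite /arc; case: onth => [e|]; apply: around_axis_continuous => u /=.
- apply: cvgD; apply: cvgMl; last exact: cvg_id.
  by apply: cvgB; [exact: cvg_cst | exact: cvg_id].
- apply: cvgMr; apply: cvgM; first exact: cvg_id.
  by apply: cvgB; [exact: cvg_cst | exact: cvg_id].
- exact: cvg_cst.
- exact: cvg_cst.
Qed.

(* The last clause says that each fibre of c is a single orbit: e stands for any
   symmetric and transitive relation containing f. *)
Definition orbit_classifier (p : nat) (f : nat -> nat) (N : nat) (c : nat -> nat) :=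
  [/\ forall i, (i < p)%N -> (c i < N)%N,
     forall i, (i < p)%N -> c (f i) = c i,
     forall k, (k < N)%N -> exists2 i, (i < p)%N & c i = k
   & forall e : nat -> nat -> Prop,
       (forall i j, e i j -> e j i) ->
       (forall i j k, e i j -> e j k -> e i k) ->
       (forall i, (i < p)%N -> e i (f i)) ->
       forall i j, (i < p)%N -> (j < p)%N -> c i = c j -> e i j].

(** Arcs are indexed by the slab and by the position where their strand starts at the bottom of the
    braid; the inverse word finds this start from any position in the slab. *)
Lemma braid_closure_arcs (R : realType) (p : nat) (w : braid_word p) :
  braid_closure R w = \bigcup_(a in [set: 'I_(size w).+1 * 'I_p])
    [set around_axis (size w).+1%:R (arc R w a.1 (braid_perm (take a.1 w) a.2) u)
       | u in `[0, 1]].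
Proof.
have onto (t i : nat) : (i < p)%N -> exists i0 : 'I_p, braid_perm (take t w) i0 = i.
  move=> ip; exists (Ordinal (braid_perm_lt (braid_inv (take t w)) ip)) => /=.
  by rewrite -{1}[take t w]braid_invK braid_perm_inv.
have onthw (t : 'I_(size w)) : onth w t = Some (tnth (in_tuple w) t).
  by rewrite onthE (tnth_nth (tnth (in_tuple w) t)) (nth_map (tnth (in_tuple w) t)).
apply/seteqP; split=> z.
  case=> _ [[t [i [u [u0 u1 ->]]]]|[i [u [u0 u1 ->]]]] <-.
    have [i0 i0E] := onto t i (ltn_ord i).
    exists (widen_ord (leqnSn _) t, i0) => //; exists u; rewrite /= ?in_itv /= ?u0 //.
    by rewrite i0E /arc /= onthw.
  have [i0 i0E] := onto (size w) i (ltn_ord i).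
  exists (ord_max, i0) => //; exists u; rewrite /= ?in_itv /= ?u0 //.
  by rewrite i0E /arc onth_default.
case=> -[t i0] _ [u]; rewrite /= in_itv /= => /andP[u0 u1] <-.
have ip : (braid_perm (take t w) i0 < p)%N by exact: braid_perm_lt.
exists (arc R w t (braid_perm (take t w) i0) u) => //.
have := ltn_ord t; rewrite ltnS leq_eqVlt => /orP[/eqP tw|tw].
  right; exists (Ordinal ip), u; split=> //.
  by rewrite /arc /= tw onth_default.
left; exists (Ordinal tw), (Ordinal ip), u; split=> //.
by rewrite /arc (onthw (Ordinal tw)).
Qed.

(** Equal heights leave two cases: one slab, where distinct arcs are disjoint, or the top of a slab
    and the bottom of the next, where positions coincide. Injectivity of the permutation then
    returns to the start. *)
Lemma arc_meet_level (R : realType) (p : nat) (w : braid_word p) (t t' i i' : nat)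
    (u u' : R) :
  0 <= u <= 1 -> 0 <= u' <= 1 ->
  arc R w t (braid_perm (take t w) i) u = arc R w t' (braid_perm (take t' w) i') u' ->
  i = i'.
Proof.
have perm_inj v : injective (@braid_perm p v) := can_inj (@braid_perm_inv p v).
wlog tt' : t t' i i' u u' / (t <= t')%N.
  move=> H u01 u'01 E; case/orP: (leq_total t t') => tt'; first exact: H E.
  by apply: esym; exact: H (esym E).
move=> u01 u'01; have [/andP[u0 u1] /andP[u'0 u'1]] := (u01, u'01) => E.
have ttE : t%:R + u = t'%:R + u' by have := congr1 snd E.
have [tE|tn] := eqVneq t t'.
  have uE : u = u' by move: ttE; rewrite tE => /addrI.
  rewrite -uE -tE in E; apply: perm_inj; exact: arc_inj u01 E.
have t1 : t%:R + 1 <= t'%:R :> R by rewrite natr1 ler_nat; lia.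
have uE : u = 1 by lra.
have u'E : u' = 0 by lra.
have {t1}tE : t' = t.+1.
  by apply/eqP; rewrite -(eqr_nat R) -natr1; apply/eqP; lra.
move: E; rewrite uE u'E tE arc1 arc0 -braid_perm_takeS => -[/eqP].
by rewrite eqr_nat eqSS => /eqP /perm_inj.
Qed.

(** Wrapping adds only the meetings between height 0 and full height, where the strand from [i] has
    position [braid_perm w i]. *)
Lemma arc_meet (R : realType) (p : nat) (w : braid_word p) (t t' i i' : nat)
    (u u' : R) :
  (t <= size w)%N -> (t' <= size w)%N -> 0 <= u <= 1 -> 0 <= u' <= 1 ->
  around_axis (size w).+1%:R (arc R w t (braid_perm (take t w) i) u) =
  around_axis (size w).+1%:R (arc R w t' (braid_perm (take t' w) i') u') ->
  [\/ i = i', i = braid_perm w i' | i' = braid_perm w i].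
Proof.
have pos s (v : R) j : 0 <= v <= 1 -> 0 < (arc R w s (braid_perm (take s w) j) v).1.1.
  exact: arc_gt0.
have bounds s (v : R) : (s <= size w)%N -> 0 <= v <= 1 -> 0 <= s%:R + v <= (size w).+1%:R.
  rewrite -(ler_nat R) => sw /andP[v0 v1]; rewrite addr_ge0 //= -natr1.
  exact: lerD.
have ends s s' j j' (v v' : R) : (s' <= size w)%N -> 0 <= v <= 1 -> 0 <= v' <= 1 ->
    s%:R + v = 0 -> s'%:R + v' = (size w).+1%:R ->
    (arc R w s (braid_perm (take s w) j) v).1.1 =
    (arc R w s' (braid_perm (take s' w) j') v').1.1 -> j = braid_perm w j'.
  rewrite -(ler_nat R) => s'w /andP[v0 v1] /andP[v'0 v'1] sv s'v'.
  have s0 : 0 <= s%:R :> R by [].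
  have /eqP := sv; rewrite paddr_eq0 // pnatr_eq0 => /andP[/eqP sE /eqP vE].
  rewrite -natr1 in s'v'; have v'E : v' = 1 by lra.
  have {s'w}s'E : s' = size w by apply/eqP; rewrite -(eqr_nat R); apply/eqP; lra.
  rewrite sE vE s'E v'E arc0 arc1 take0 onth_default // take_size /= => /eqP.
  by rewrite eqr_nat eqSS => /eqP.
move=> tw t'w u01 u'01.
have := arc_meet_level (w := w) (t := t) (t' := t') (i := i) (i' := i') u01 u'01.
move: (pos t u i u01) (pos t' u' i' u'01).
have := ends t t' i i' u u' t'w u01 u'01; have := ends t' t i' i u' u tw u'01 u01.
have := bounds t u tw u01; have := bounds t' u' t'w u'01.
rewrite /arc; case: (match onth w t with Some _ => _ | None => _ end) => x y.
case: (match onth w t' with Some _ => _ | None => _ end) => x' y' /=.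
move=> bt' bt end1 end2 x0 x'0 level.
move=> /(around_axis_inj x0 x'0 bt bt')[xx yy [tt|[t0 th]|[th t0]]].
- by constructor 1; apply: level; rewrite xx yy tt.
- by constructor 2; exact: end2.
- by constructor 3; exact: end1.
Qed.

(** Each arc is classified by the value of [c] at the start of its strand. Arcs that meet agree
    because [c] is invariant; arcs with equal values are linked strand by strand along the orbit. *)
Lemma num_components_braid_closure (R : realType) (p : nat) (w : braid_word p)
    (N : nat) (c : nat -> nat) :
  orbit_classifier p (braid_perm w) N c -> num_components (braid_closure R w) = N.
Proof.
move=> [c_lt c_inv c_onto c_link].
pose h : R := (size w).+1%:R.
pose K (a : 'I_(size w).+1 * 'I_p) :=
  [set around_axis h (arc R w a.1 (braid_perm (take a.1 w) a.2) u) | u in `[0, 1]].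
have K_mem a u : 0 <= u <= 1 ->
    K a (around_axis h (arc R w a.1 (braid_perm (take a.1 w) a.2) u)).
  by exists u; rewrite /= ?in_itv.
have K0 a : K a (around_axis h ((braid_perm (take a.1 w) a.2).+1%:R, 0, a.1%:R)).
  by rewrite -(arc0 R w); apply: K_mem; rewrite lexx ler01.
have K1 a : K a (around_axis h ((braid_perm (take a.1.+1 w) a.2).+1%:R, 0, a.1.+1%:R)).
  by rewrite braid_perm_takeS -(arc1 R w); apply: K_mem; rewrite lexx ler01.
have K_conn a : connected (K a).
  apply: connected_continuous_connected; first exact: segment_connected.
  by apply: continuous_subspaceT; exact: around_axis_arc_continuous.
have K_closed a : closed (K a).
  apply: compact_closed; first exact: norm_hausdorff.
  apply: continuous_compact; last exact: segment_compact.
  by apply: continuous_subspaceT; exact: around_axis_arc_continuous.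
have defA : braid_closure R w = \bigcup_(a in setT) K a by exact: braid_closure_arcs.
have linkK a x y : K a x -> K a y -> connected_component (braid_closure R w) x y.
  move=> Kx Ky; exists (K a) => //; split=> // z Kz.
  by rewrite defA; exists a.
pose start i : R * R * R := around_axis h (i.+1%:R, 0, 0).
(* Consecutive arcs of a strand share an end point, so induction on the slab links each of them to
   the start. *)
have link_level t i x : K (t, i) x -> connected_component (braid_closure R w) (start i) x.
  case: t => t tw; elim: t tw x => [|t IH] tw x Kx.
    by apply: (linkK _ _ _ _ Kx); have := K0 (Ordinal tw, i); rewrite take0.
  apply: connected_component_trans (linkK _ _ _ (K0 _) Kx).
  exact: IH (K1 (Ordinal (ltnW tw), i)).
(* The top of the closing arc of strand [i] is glued to the start of strand [braid_perm w i]. *)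
have link_perm (i : 'I_p) :
    connected_component (braid_closure R w) (start i) (start (braid_perm w i)).
  have := K1 (ord_max, i).
  rewrite [X in around_axis h X]/= take_oversize // around_axis_period ?pnatr_eq0 //.
  exact: link_level.
have cK (a : 'I_(size w).+1 * 'I_p) : (c a.2 < N)%N by exact: c_lt.
apply: (num_components_classifier (K := K) (c := fun a => Ordinal (cK a))) => //.
- by move=> a; eexists; exact: K0.
- move=> [t i] [t' i'] [z [[u /= u01 uz] [u' /= u'01 u'z]]]; apply: val_inj => /=.
  rewrite !in_itv /= in u01 u'01.
  have := arc_meet (ltn_ord t) (ltn_ord t') u01 u'01 (etrans uz (esym u'z)).
  by case=> ->; rewrite ?c_inv.
- move=> k; have [i ip ci] := c_onto _ (ltn_ord k).
  by exists (ord0, Ordinal ip); exact: val_inj.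
- move=> [t i] [t' i'] x y [cE] Kx Ky.
  apply: connected_component_trans (link_level _ _ _ Ky).
  apply: (connected_component_trans (connected_component_sym (link_level _ _ _ Kx))).
  pose e j k := connected_component (braid_closure R w) (start j) (start k).
  apply: (c_link e) => //.
  + by move=> j k; exact: connected_component_sym.
  + by move=> j k l; exact: connected_component_trans.
  + by move=> j jp; exact: (link_perm (Ordinal jp)).
Qed.

(** * The permutation of a twisted torus braid *)

Lemma sigma_prod_val (p r : nat) :
  (r <= p)%N -> [seq val e.1 | e <- sigma_prod p r] = iota 0 r.-1.
Proof.
move=> rp; rewrite /sigma_prod -map_comp.
rewrite (_ : map _ _ = map val (seq.filter (preim val (gtn r.-1)) (enum 'I_p.-1))) //.
rewrite -filter_map val_enum_ord.
have -> : p.-1 = (r.-1 + (p.-1 - r.-1))%N by lia.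
rewrite iotaD filter_cat (all_filterP _); last by apply/allP => k; rewrite mem_iota.
rewrite -[RHS]cats0; congr (_ ++ _); rewrite (eq_in_filter (a2 := pred0)) ?filter_pred0 //.
by move=> k; rewrite mem_iota => ? /=; lia.
Qed.

Lemma foldl_swap_next_iota (m i : nat) :
  foldl (fun j k => swap_next k j) i (iota 0 m) =
  if (i <= m)%N then if i is i'.+1 then i' else m else i.
Proof.
elim: m => [|m IH]; first by case: i.
rewrite -[in iota _ _]addn1 iotaD foldl_cat IH /= /swap_next.
case: i {IH} => [|i]; rewrite ?leq0n; repeat (case: ifP => //); lia.
Qed.

(* Subtracting 1 modulo r is written as adding r - 1. *)
Lemma braid_perm_sigma_prod (p r i : nat) :
  (0 < r)%N -> (r <= p)%N ->
  braid_perm (sigma_prod p r) i = if (i < r)%N then ((i + r.-1) %% r)%N else i.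
Proof.
move=> r0 rp.
have -> : braid_perm (sigma_prod p r) i =
    foldl (fun j k => swap_next k j) i [seq val e.1 | e <- sigma_prod p r].
  by rewrite /braid_perm; elim: (sigma_prod p r) i => //= e w IH i; rewrite IH.
rewrite sigma_prod_val // foldl_swap_next_iota.
have -> : (i <= r.-1)%N = (i < r)%N by lia.
case: ifP => // ir; case: i ir => [|i] ir; first by rewrite add0n modn_small //; lia.
have -> : (i.+1 + r.-1 = i + r)%N by lia.
by rewrite modnDr modn_small //; lia.
Qed.

Lemma braid_perm_exp (p : nat) (w : braid_word p) (n i : nat) :
  braid_perm (braid_exp w n%:Z) i = iter n (braid_perm w) i.
Proof.
elim: n i => [|n IH] i //.
by rewrite iterSr -IH /= braid_perm_cat.
Qed.

Lemma braid_perm_expN (p : nat) (w : braid_word p) (n i : nat) :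
  braid_perm (braid_exp w (- n%:Z)) i = iter n (braid_perm (braid_inv w)) i.
Proof. by rewrite -braid_perm_exp; case: n. Qed.

Lemma braid_perm_sigma_prod_exp (p r n i : nat) :
  (0 < r)%N -> (r <= p)%N ->
  braid_perm (braid_exp (sigma_prod p r) n%:Z) i =
  if (i < r)%N then ((i + n * r.-1) %% r)%N else i.
Proof.
move=> r0 rp; rewrite braid_perm_exp; elim: n => [|n IH] /=.
  by rewrite addn0; case: ifP => // ir; rewrite modn_small.
rewrite {}IH braid_perm_sigma_prod //; case: (ltnP i r) => ir; last by rewrite ltnNge ir.
by rewrite ltn_mod r0 modnDml; congr (_ %% _)%N; lia.
Qed.

Lemma braid_perm_sigma_prod_expN (p r n i : nat) :
  (0 < r)%N -> (r <= p)%N ->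
  braid_perm (braid_exp (sigma_prod p r) (- n%:Z)) i =
  if (i < r)%N then ((i + n) %% r)%N else i.
Proof.
move=> r0 rp; rewrite braid_perm_expN; elim: n => [|n IH] /=.
  by rewrite addn0; case: ifP => // ir; rewrite modn_small.
rewrite {}IH; case: ifP => ir; last first.
  by rewrite -{1}[i](_ : braid_perm (sigma_prod p r) i = i) ?braid_perm_inv //
    braid_perm_sigma_prod // ir.
(* The right-hand side becomes the inverse word applied to its own image under the word, and that
   image is [i + n] modulo [r]. *)
rewrite -[RHS](@braid_perm_inv _ (sigma_prod p r)) braid_perm_sigma_prod //.
rewrite ltn_mod r0 modnDml; congr braid_perm.
have -> : (i + n.+1 + r.-1 = i + n + r)%N by lia.
by rewrite modnDr.
Qed.

(** * Orbits of rotations and of the twisted torus permutation *)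

(** The gcd divides [n] and [s], so residues modulo it are invariant. Conversely, by Bezout, some
    multiple of [s] equals the gcd modulo [n], so repeated steps join equal residues. *)
Lemma orbit_classifier_rotation (n s : nat) :
  (0 < n)%N ->
  orbit_classifier n (fun i => (i + s) %% n)%N (gcdn n s) (fun i => i %% gcdn n s)%N.
Proof.
move=> n0; have g0 : (0 < gcdn n s)%N by rewrite gcdn_gt0 n0.
split=> [i _|i _|k kg|e esym etrans estep i j].
- by rewrite ltn_mod.
- by rewrite modn_dvdm ?dvdn_gcdl // -modnDmr (eqP (dvdn_gcdr n s)) addn0.
- exists k; last by rewrite modn_small.
  by apply: leq_trans kg _; rewrite dvdn_leq // dvdn_gcdl.
have reach k a : (a < n)%N -> e a ((a + k * s) %% n)%N.
  move=> an; elim: k => [|k IH].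
    by rewrite addn0 modn_small //; apply: etrans (esym _ _ _); exact: estep.
  apply: (etrans _ _ _ IH); have := estep ((a + k * s) %% n)%N; rewrite ltn_mod => /(_ n0).
  by rewrite modnDml -addnA -mulSnr.
wlog ij : i j / (i <= j)%N.
  move=> H ip jp cij; case/orP: (leq_total i j) => ij; first exact: H.
  by apply: (esym); apply: H.
move=> ip jp /eqP; rewrite eq_sym eqn_mod_dvd // => /dvdnP[m mE].
have [s0|s0] := posnP s.
  move: mE; rewrite s0 gcdn0 => mE; have := reach 0 i ip; rewrite addn0 modn_small //.
  by case: m mE => [|m] mE; [have -> : j = i by lia | rewrite mulSn in mE; lia].
(* Here [j - i] is [m] times the gcd, and [km] steps advance by the gcd modulo [n]. *)
case: (egcdnP n s0) => km kn bez _; have := reach (m * km)%N i ip.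
suff -> : (i + m * km * s = j + m * kn * n)%N by rewrite addnC modnMDl modn_small.
rewrite -mulnA bez gcdnC; nia.
Qed.

Lemma eq_orbit_classifier (p : nat) (f f' : nat -> nat) (N : nat) (c : nat -> nat) :
  (forall i, (i < p)%N -> f i = f' i) ->
  orbit_classifier p f' N c -> orbit_classifier p f N c.
Proof.
move=> ff' [c1 c2 c3 c4]; split=> // [i ip|e es et ef]; first by rewrite ff' ?c2.
by apply: c4 => // i ip; rewrite -ff' //; exact: ef.
Qed.

(** For [i < p] and [q <= p] this is subtraction of [q] modulo [p], split into cases to suit linear
    arithmetic. *)
Definition torus_perm (p q i : nat) : nat := if (q <= i)%N then (i - q)%N else (i + p - q)%N.

Lemma torus_permE (p q i : nat) : (0 < p)%N -> (q <= p)%N -> (i < p)%N ->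
  ((i + q * p.-1) %% p)%N = torus_perm p q i.
Proof.
move=> p0 qp ip; rewrite /torus_perm; case: leqP => qi.
  have -> : (i + q * p.-1 = q * p + (i - q))%N by nia.
  by rewrite modnMDl modn_small //; lia.
case: q qp qi => [|q] // qp qi.
have -> : (i + q.+1 * p.-1 = q * p + (i + p - q.+1))%N by nia.
by rewrite modnMDl modn_small //; lia.
Qed.

(* The points of [q, r) are fixed; deleting them leaves the rotation by p - r
   on p - r + q points. *)
Lemma orbit_classifier_neg (p q r : nat) :
  (0 < q)%N -> (q < r)%N -> (r <= p)%N ->
  orbit_classifier p
    (fun i => let j := torus_perm p q i in
              if (j < r)%N then (j + q) %% r else j)%N
    (r - q + gcdn q (p - r))%N
    (fun i => if i < q then i %% gcdn q (p - r)
              else if i < r then gcdn q (p - r) + (i - q)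
              else (i - r) %% gcdn q (p - r))%N.
Proof.
move=> q0 qr rp; set g := gcdn q (p - r).
have g0 : (0 < g)%N by rewrite gcdn_gt0 q0.
have gq : (g <= q)%N by rewrite dvdn_leq // dvdn_gcdl.
pose f i := (if i < q then if i + p - q < r then i + p - r else i + p - q
             else if i < r then i else if i < q + r then i - r else i - q)%N.
apply: (@eq_orbit_classifier _ _ f) => [i ip|].
  rewrite /f /torus_perm /=.
  have wrap j : (r <= j)%N -> (j < r + r)%N -> (j %% r = j - r)%N.
    by move=> rj jr; rewrite -{1}(subnK rj) modnDr modn_small //; lia.
  case: (ltnP i q) => iq.
    by case: ifP => ipr //; rewrite wrap; lia.
  case: (ltnP i r) => ir.
    by (have -> : (i - q < r)%N by lia); rewrite subnK // modn_small.
  case: (ltnP i (q + r)) => iqr.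
    by (have -> : (i - q < r)%N by lia); rewrite subnK // wrap //; lia.
  by have -> // : (i - q < r)%N = false by lia.
have [rot_lt rot_inv rot_onto rot_link] :=
  @orbit_classifier_rotation (p - r + q) (p - r) ltac:(lia).
have gE : gcdn (p - r + q) (p - r) = g by rewrite gcdnC gcdnDl gcdnC.
have modD a b : (g %| b)%N -> ((a + b) %% g = a %% g)%N.
  by move=> /dvdnP[k ->]; rewrite addnC modnMDl.
have gdq : (g %| q)%N := dvdn_gcdl _ _.
have gdpr : (g %| p - r)%N := dvdn_gcdr _ _.
split=> [i ip|i ip|k kg|e esym etrans estep].
- by have := ltn_pmod i g0; have := ltn_pmod (i - r) g0; do 2?[case: ifP => ?]; lia.
- rewrite /f; case: (ltnP i q) => iq.
    case: (ltnP (i + p - q) r) => ipr.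
      have -> : (i + p - r < q)%N by lia.
      by rewrite -addnBA // modD.
    have -> : (i + p - q < q)%N = false by lia.
    have -> : (i + p - q - r = i + (p - r) - q)%N by lia.
    have qle : (q <= i + (p - r))%N by lia.
    by rewrite [(i + p - q < r)%N]ltnNge ipr /= -(modD _ q) // subnK // modD.
  case: (ltnP i r) => ir; first by rewrite ltnNge iq /= ir.
  case: (ltnP i (q + r)) => iqr.
    by have -> : (i - r < q)%N by lia.
  have -> : (i - q < q)%N = false by lia.
  have -> : (i - q < r)%N = false by lia.
  by rewrite -(modD (i - q - r)%N q) //; congr (_ %% _)%N; lia.
- case: (ltnP k g) => kg'; last first.
    exists (k - g + q)%N; first by lia.
    have -> : (k - g + q < q)%N = false by lia.
    by (have -> : (k - g + q < r)%N by lia); lia.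
  by exists k; [lia | (have -> : (k < q)%N by lia); rewrite modn_small].
(* [psi] reinserts the deleted gap from [q] to [r] and carries the rotation to [f]. *)
pose psi a := (if a < q then a else a - q + r)%N.
have link a b : (a < p - r + q)%N -> (b < p - r + q)%N -> a = b %[mod g] ->
    e (psi a) (psi b).
  move=> alt blt ab; apply: (rot_link (fun a b => e (psi a) (psi b))) => //.
  - by move=> x y; exact: esym.
  - by move=> x y z; exact: etrans.
  - move=> x xlt; suff -> : psi ((x + (p - r)) %% (p - r + q))%N = f (psi x).
      by apply: estep; rewrite /psi; case: ifP; lia.
    rewrite /psi; case: (ltnP x q) => xq.
      by rewrite modn_small; [rewrite /f xq; case: ifP; case: ifP; lia | lia].
    have -> : (x + (p - r) = x - q + (p - r + q))%N by lia.
    rewrite modnDr modn_small; last by lia.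
    by rewrite /f; repeat (case: ifP => ?); lia.
  - by rewrite gE.
have refl i : (i < p)%N -> e i i.
  by move=> ip; apply: (etrans _ (f i)); [|apply: (esym)]; exact: estep.
have psiE i : (i < q)%N || (r <= i)%N ->
    psi (if i < q then i else i - r + q)%N = i.
  by rewrite /psi; case: (ltnP i q) => /= iq ir; [rewrite iq | case: ifP; lia].
have unpsi_lt i : (i < p)%N -> (i < q)%N || (r <= i)%N ->
    ((if i < q then i else i - r + q) < p - r + q)%N.
  by case: (ltnP i q) => /= iq ip ir; lia.
have out i : (i < q)%N || (r <= i)%N ->
  (if i < q then i %% g else if i < r then g + (i - q) else (i - r) %% g)%N =
  ((if i < q then i else i - r + q) %% g)%N.
  case: (ltnP i q) => //= iq ir; by rewrite ltnNge ir /= modD.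
move=> i j ip jp.
(* Fixed points have distinct values, all at least [g]; the other points have values below [g].
   Mixed cases are thus impossible. *)
case iout: ((i < q) || (r <= i))%N; case jout: ((j < q) || (r <= j))%N.
- rewrite !out // => cij; rewrite -(psiE i) // -(psiE j) //.
  by apply: link cij; exact: unpsi_lt.
- rewrite out //; have -> : (j < q)%N = false by lia.
  have -> : (j < r)%N by lia.
  by move=> cij; have := ltn_pmod (if i < q then i else i - r + q)%N g0; rewrite cij; lia.
- rewrite [RHS]out //; have -> : (i < q)%N = false by lia.
  have -> : (i < r)%N by lia.
  by move=> cij; have := ltn_pmod (if j < q then j else j - r + q)%N g0; rewrite -cij; lia.
- have -> : (i < q)%N = false by lia.
  have -> : (j < q)%N = false by lia.
  have -> : (i < r)%N by lia.
  have -> : (j < r)%N by lia.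
  by move=> ij; (have -> : i = j by lia); exact: refl.
Qed.

(* [T m] is the point of [0, q) that the orbit of m in [q, 2q) runs through.  The
   points j with j mod 2q = m, j < r, share the orbit of m, whereas j >= r lies in
   the orbit of j mod q; hence the orbits are those of the rotation by p on q
   points. *)
Lemma orbit_classifier_pos (p q r : nat) (T : nat -> nat) :
  let T' m := if (m < q)%N then m else T m in
  (0 < q)%N -> (q <= r)%N -> (r <= p)%N ->
  (forall m, (q <= m < 2 * q)%N -> (T m < q)%N) ->
  (forall m, (q <= m < 2 * q)%N -> T' ((m + r) %% (2 * q))%N = T m) ->
  (forall m, (r <= m < r + q)%N -> T' (m %% (2 * q))%N = m %% q)%N ->
  (forall e : nat -> nat -> Prop, (forall i j, e i j -> e j i) ->
     (forall i j k, e i j -> e j k -> e i k) ->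
     (forall m, (q <= m < 2 * q)%N -> e m ((m + r) %% (2 * q))%N) ->
     forall m, (q <= m < 2 * q)%N -> e m (T m)) ->
  orbit_classifier p
    (fun i => let j := torus_perm p q i in if (j < r)%N then torus_perm r q j else j)
    (gcdn p q)
    (fun i => (if i < r then T' (i %% (2 * q)) else i) %% gcdn p q)%N.
Proof.
move=> T' q0 qr rp T_lt T_inv T_r T_link; set g := gcdn p q.
have g0 : (0 < g)%N by rewrite gcdn_gt0 q0 orbT.
(* With [v = i], or [v = i + p] when [i < q], the first rotation gives [v - q]; the second acts on
   it only when [v - q < r]. *)
pose H v := (if v < 2 * q then v + r - 2 * q else if v < r + q then v - 2 * q
             else v - q)%N.
apply: (@eq_orbit_classifier _ _ (fun i => H (if q <= i then i else i + p)%N)) => [i ip|].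
  by rewrite /H /torus_perm /=; case: (leqP q i) => ?; repeat (case: ifP => ?); lia.
pose c v := ((if v < r then T' (v %% (2 * q)) else v) %% g)%N.
have sub2 v : (2 * q <= v)%N -> ((v - 2 * q) %% (2 * q) = v %% (2 * q))%N.
  by move=> v2; rewrite -{2}(subnK v2) modnDr.
have modg v : ((v %% q) %% g = v %% g)%N by rewrite modn_dvdm // dvdn_gcdr.
have c_small v : (v < q)%N -> c v = (v %% g)%N.
  move=> vq; have vr : (v < r)%N by lia.
  have v2 : (v < 2 * q)%N by lia.
  by rewrite /c vr (modn_small v2) /T' vq.
(* The first branch of [H] rests on [T_inv]; the others subtract [2q] or [q], which keeps the
   relevant residue. When [H] passes from [v >= r] to below [r], [T_r] reconciles the two formulas
   for [c]. *)
have c_H v : (q <= v < p + q)%N -> c (H v) = c v.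
  move=> /andP[qv vpq]; rewrite /H; case: (ltnP v (2 * q)) => v2.
    have vr : (v + r - 2 * q < r)%N by lia.
    have T'v : T' (v %% (2 * q))%N = T v by rewrite modn_small // /T' ltnNge qv.
    rewrite {1}/c vr sub2; last by lia.
    rewrite T_inv ?qv // /c; case: ltnP => rv; first by rewrite T'v.
    by rewrite -[RHS]modg -T_r ?rv ?T'v //; lia.
  case: (ltnP v (r + q)) => vrq.
    have vr : (v - 2 * q < r)%N by lia.
    rewrite /c vr sub2 //; case: (ltnP v r) => // rv.
    by rewrite T_r ?modg // rv.
  rewrite /c; have -> : (v - q < r)%N = false by lia.
  have -> : (v < r)%N = false by lia.
  by rewrite -modg -[in RHS]modg -{2}(subnK qv) modnDr.
split=> [i ip|i ip|k kg|e esym etrans estep].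
- by rewrite ltn_mod.
- rewrite -/(c _) -/(c i) c_H; last by case: ifP; lia.
  case: leqP => // iq; rewrite (c_small i) // /c.
  have -> : (i + p < r)%N = false by lia.
  by rewrite -modnDmr (eqP (dvdn_gcdl p q)) addn0.
- have kq : (k < q)%N by apply: leq_trans kg _; rewrite dvdn_leq // dvdn_gcdr.
  by exists k; [lia | rewrite -/(c k) c_small // modn_small].
have refl i : (i < p)%N -> e i i.
  by move=> ip; apply: etrans (esym _ _ _); exact: estep.
(* Points of [p, p + q) stand for those of [0, q). *)
pose u v := if (v < p)%N then v else (v - p)%N.
pose E v w := e (u v) (u w).
have Esym v w : E v w -> E w v by exact: esym.
have Etrans v w x : E v w -> E w x -> E v x by exact: etrans.
have Erefl v : (v < p + q)%N -> E v v.
  by move=> vpq; apply: refl; rewrite /u; case: ifP; lia.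
have E_H v : (q <= v < p + q)%N -> E v (H v).
  move=> /andP[qv vpq]; have Hp : (H v < p)%N by rewrite /H; repeat (case: ifP => ?); lia.
  rewrite /E {2}/u Hp /u; case: (ltnP v p) => vp.
    by have := estep v vp; rewrite qv.
  have vpp : (v - p < p)%N by lia.
  by have := estep _ vpp; (have -> : (q <= v - p)%N = false by lia); rewrite subnK.
(* Below [r + q], [H] subtracts [2q] as long as the value is at least [2q]. *)
have E_mod2 v : (v < p + q)%N -> (v < r + q)%N -> E v (v %% (2 * q))%N.
  elim/ltn_ind: v => v IH vpq vrq; case: (ltnP v (2 * q)) => v2.
    by rewrite modn_small //; exact: Erefl.
  have Hv : H v = (v - 2 * q)%N by rewrite /H; repeat (case: ifP => ?); lia.
  apply: (@Etrans _ (H v)); first by apply: E_H; lia.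
  by rewrite Hv -sub2 //; apply: IH; lia.
(* [H] sends [m] to [m + r - 2q], which is linked to the residue of [m + r] modulo [2q]; so [T_link]
   applies to [E]. *)
have E_T m : (q <= m < 2 * q)%N -> E m (T m).
  apply: T_link => // {}m /andP[qm m2].
  apply: (@Etrans _ (H m)); first by apply: E_H; lia.
  rewrite /H m2 -sub2; last by lia.
  by apply: E_mod2; lia.
have E_T' m : (m < 2 * q)%N -> E m (T' m).
  by move=> m2; rewrite /T'; case: ltnP => qm; [apply: Erefl | apply: E_T]; lia.
have mod2_lt v : (v %% (2 * q) < 2 * q)%N by rewrite ltn_mod; lia.
(* From [r + q] on, [H] subtracts [q] until the value is below [r + q], where [T_r] yields the
   residue modulo [q]. *)
have E_mod v : (r <= v < p + q)%N -> E v (v %% q)%N.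
  elim/ltn_ind: v => v IH /andP[rv vpq]; case: (ltnP v (r + q)) => vrq.
    apply: (@Etrans _ (v %% (2 * q))%N); first exact: E_mod2.
    by rewrite -T_r ?rv //; exact: E_T'.
  have Hv : H v = (v - q)%N by rewrite /H; repeat (case: ifP => ?); lia.
  apply: (@Etrans _ (H v)); first by apply: E_H; lia.
  have qv : (q <= v)%N by lia.
  by rewrite Hv -{2}(subnK qv) modnDr; apply: IH; lia.
have [_ _ _ rot_link] := orbit_classifier_rotation p q0.
(* [x + p] stands for the same point as [x] and is linked to its residue modulo [q], which gives the
   rotation by [p] on [q] points. *)
have E_small a b : (a < q)%N -> (b < q)%N -> a = b %[mod g] -> E a b.
  rewrite /g gcdnC; apply: rot_link => // x xq.
  apply: (@Etrans _ (x + p)%N); last by apply: E_mod; lia.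
  have -> : E x (x + p)%N = E x x; last by apply: Erefl; lia.
  by rewrite /E /u addnK; (have -> : (x + p < p)%N = false by lia); case: ifP; [|lia].
pose red v := (if v < r then T' (v %% (2 * q)) else v %% q)%N.
have red_lt v : (red v < q)%N.
  rewrite /red /T'; case: ifP => _; last by rewrite ltn_mod.
  by case: (ltnP (v %% (2 * q)) q) => // qv; apply: T_lt; rewrite qv mod2_lt.
have E_red v : (v < p)%N -> E v (red v).
  move=> vp; rewrite /red; case: ltnP => vr; last by apply: E_mod; lia.
  by apply: (@Etrans _ (v %% (2 * q))%N); [apply: E_mod2; lia | exact: E_T'].
have c_red v : c v = (red v %% g)%N by rewrite /c /red; case: ifP; rewrite ?modg.
move=> i j ip jp; rewrite -/(c i) -/(c j) !c_red => cij.
suff : E i j by rewrite /E /u ip jp.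
apply: (@Etrans _ (red i)); first exact: E_red.
apply: (@Etrans _ (red j)); last by apply: Esym; exact: E_red.
exact: E_small.
Qed.

(** From a point [m] between [q] and [2q], adding [r] modulo [2q] either climbs by 1 until it wraps
    to 0, or drops by [q] at once, or descends by 1 down to [q - 1]. Hence [T] is the constant 0,
    reduction modulo [q], or the constant [q - 1]. *)
Lemma orbit_classifier_pos_congr (p q r : nat) :
  (1 < q)%N -> (q <= r)%N -> (r <= p)%N ->
  r = 1 %[mod 2 * q] \/ r = q %[mod 2 * q] \/ r = (2 * q - 1)%N %[mod 2 * q] ->
  exists c, orbit_classifier p
    (fun i => let j := torus_perm p q i in if (j < r)%N then torus_perm r q j else j)
    (gcdn p q) c.
Proof.
move=> q1 qr rp; have q0 : (0 < q)%N by lia.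
have mod_q v : (v %% (2 * q) %% q = v %% q)%N by rewrite modn_dvdm // dvdn_mull.
have subq d : (q <= d)%N -> (d < 2 * q)%N -> (d %% q = d - q)%N.
  by move=> qd d2; rewrite -{1}(subnK qd) modnDr modn_small //; lia.
have sub2 d : (2 * q <= d)%N -> (d < 4 * q)%N -> (d %% (2 * q) = d - 2 * q)%N.
  by move=> qd d2; rewrite -{1}(subnK qd) modnDr modn_small //; lia.
(* With [d = m - r], the condition on [m] depends on [r] only through its class modulo [2q]. *)
have T_r (T : nat -> nat) s : (forall m, m + r = m + s %[mod 2 * q]) ->
    (forall d, (d < q)%N ->
       (if (d + s) %% (2 * q) < q then (d + s) %% (2 * q) else T ((d + s) %% (2 * q)))
       = (d + s) %% q)%N ->
    forall m, (r <= m < r + q)%N ->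
      (if m %% (2 * q) < q then m %% (2 * q) else T (m %% (2 * q)))%N = (m %% q)%N.
  move=> rs Ts m /andP[rm mrq].
  have mE : m = m - r + s %[mod 2 * q] by rewrite -rs subnK.
  by rewrite -[RHS]mod_q mE mod_q -Ts //; lia.
have hide s : r = s %[mod 2 * q] -> forall m, m + r = m + s %[mod 2 * q].
  by move=> rs m; rewrite -modnDmr rs modnDmr.
case=> [|[|]] => /hide rE.
- have H := @orbit_classifier_pos p q r (fun=> 0%N) q0 qr rp.
  eexists; apply: H => //=.
  + move=> m /andP[qm m2]; rewrite rE.
    have [mE|mn] := eqVneq m (2 * q - 1)%N.
      by rewrite sub2; [case: ifP; lia | lia | lia].
    by rewrite modn_small; [case: ifP; lia | lia].
  + apply: (T_r (fun=> 0%N) _ rE) => d dq; rewrite modn_small; last by lia.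
    case: ltnP => qd; first by rewrite modn_small.
    by rewrite subq; lia.
  + move=> e esym etrans estep m /andP[qm m2].
    (* [k] steps lead up from [m] to [2q - 1], and one more to 0. *)
    have [k mE] : exists k, m = (2 * q - k.+1)%N by exists (2 * q - m.+1)%N; lia.
    rewrite {}mE in qm m2 *; elim: k qm {m2} => [|k IH] qm.
      have := estep (2 * q - 1)%N; rewrite rE sub2; [|lia|lia].
      by have -> : (2 * q - 1 + 1 - 2 * q = 0)%N; [lia | apply; lia].
    apply: (etrans _ _ _ _ (IH _)); last by lia.
    have := estep (2 * q - k.+2)%N; rewrite rE modn_small; last by lia.
    by have -> : (2 * q - k.+2 + 1 = 2 * q - k.+1)%N; [lia | apply; lia].
- have H := @orbit_classifier_pos p q r (fun m => m %% q)%N q0 qr rp.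
  eexists; apply: H => //=.
  + by move=> m _; rewrite ltn_mod.
  + move=> m /andP[qm m2]; rewrite rE sub2; [|lia|lia].
    by rewrite (subq m) // ifT; lia.
  + apply: (T_r (fun m => m %% q)%N _ rE) => d dq; rewrite modn_small; last by lia.
    by case: ltnP => // qd; rewrite modn_small.
  + move=> e esym etrans estep m /andP[qm m2].
    have := estep m; rewrite rE sub2; [|lia|lia].
    rewrite qm m2 subq //; have -> : (m + q - 2 * q = m - q)%N by lia.
    by apply.
- have H := @orbit_classifier_pos p q r (fun=> q - 1)%N q0 qr rp.
  eexists; apply: H => //=.
  + by move=> m _; lia.
  + move=> m /andP[qm m2]; rewrite rE sub2; [|lia|lia].
    by case: ifP; lia.
  + apply: (T_r (fun=> q - 1)%N _ rE) => -[|d] dq.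
      by rewrite add0n modn_small; [rewrite subq; [case: ifP; lia|lia|lia]|lia].
    have -> : (d.+1 + (2 * q - 1) = 2 * q + d)%N by lia.
    by rewrite modnDl modnMDl !modn_small ?ifT; lia.
  + move=> e esym etrans estep m /andP[qm m2].
    (* [k] steps lead down from [m] to [q], and one more to [q - 1]. *)
    have [k mE] : exists k, m = (k + q)%N by exists (m - q)%N; lia.
    rewrite {}mE in qm m2 *; elim: k {qm} m2 => [|k IH] m2.
      have := estep q; rewrite rE sub2; [|lia|lia].
      by have -> : (q + (2 * q - 1) - 2 * q = q - 1)%N; [lia | apply; lia].
    apply: (etrans _ _ _ _ (IH _)); last by lia.
    have := estep (k.+1 + q)%N; rewrite rE sub2; [|lia|lia].
    by have -> : (k.+1 + q + (2 * q - 1) - 2 * q = k + q)%N; [lia | apply; lia].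
Qed.

(** * Component counts of the twisted torus links *)

Theorem theorem3p3 (R : realType) (p q r : nat)
    (hr : (0 < r)%N) (hrp : (r <= p)%N) (hq : (0 < q)%N)
    (hpq : p <> 0 %[mod q]) :
  ((r = 1 %[mod 2 * q] \/ r = q %[mod 2 * q] \/ r = (2 * q - 1)%N %[mod 2 * q])
     -> NC R p q%:Z r q%:Z = gcdn p q)
  /\ ((q < r)%N ->
      (NC R p q%:Z r (- q%:Z))%:Z = r%:Z - q%:Z + gcdz q%:Z (r%:Z - p%:Z)).
Proof.
have p0 : (0 < p)%N by apply: leq_trans hrp.
have q1 : (1 < q)%N.
  by rewrite ltn_neqAle hq andbT; apply/eqP => qE; apply: hpq; rewrite -qE !modn1.
split=> [hmod|qr]; rewrite /NC /twisted_torus_link /twisted_torus_braid.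
  have [c hc] : exists c, orbit_classifier p
      (fun i => let j := ((i + q * p.-1) %% p)%N in
                if (j < r)%N then ((j + q * r.-1) %% r)%N else j) (gcdn p q) c.
    have [qr|rq] := leqP q r.
      have [c hc] := orbit_classifier_pos_congr q1 qr hrp hmod.
      exists c; apply: eq_orbit_classifier hc => i ip /=.
      rewrite torus_permE // ?(leq_trans qr) //.
      by case: ltnP => // jr; rewrite torus_permE.
    (* As [r < q], the residues [q] and [2q - 1] are excluded; with [r = 1] the twist is trivial and
       only the rotation of [p] points remains. *)
    have r1 : r = 1%N.
      case: hmod => [|[]]; rewrite !modn_small; lia.
    (* The rotation is by [q * (p - 1)], and [p - 1] is coprime to [p]. *)
    rewrite -[gcdn p q](@Gauss_gcdl _ _ p.-1) ?coprimenP //.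
    exists (fun i => i %% gcdn p (q * p.-1))%N.
    apply: eq_orbit_classifier (orbit_classifier_rotation _ p0) => i ip /=.
    by rewrite r1 modn1; case: ltnP => //; rewrite ltnS leqn0 => /eqP.
  apply: (num_components_braid_closure R (c := c)).
  apply: eq_orbit_classifier hc => i ip.
  by rewrite braid_perm_cat !braid_perm_sigma_prod_exp // ip.
have -> : gcdz q%:Z (r%:Z - p%:Z) = gcdn q (p - r).
  by rewrite /gcdz distnC distnEl.
rewrite subzn ?(ltnW qr) // -PoszD; congr Posz.
apply: num_components_braid_closure.
apply: eq_orbit_classifier (orbit_classifier_neg hq qr hrp) => i ip /=.
rewrite braid_perm_cat braid_perm_sigma_prod_exp // ip braid_perm_sigma_prod_expN //.
by rewrite torus_permE // (leq_trans (ltnW qr)).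
Qed.
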